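(* Let $\Gamma$ be a rationally metrised graph and $u,v$ vertices of $\Gamma$. Let $\mathrm W_\bullet$ be the filtration of $\mathbb Q\pi_1(\Gamma;u,v)$ given by $\mathrm W_{-k}\mathbb Q\pi_1(\Gamma;u,v)=\mathbb Q\pi_1(\Gamma;u,v)\cdot J^k$, where $J$ is the augmentation ideal of the group algebra $\mathbb Q\pi_1(\Gamma,u)$. Then for every $n\ge0$ the higher cycle pairing induces a perfect pairing \[\int\colon\mathbb Q\pi_1(\Gamma;u,v)/\mathrm W_{-n-1}\otimes\textstyle\bigoplus_{m\le n}\mathrm H_1(\Gamma)^{\otimes m}\to\mathbb Q,\] and the resulting isomorphisms $\mathbb Q\pi_1(\Gamma;u,v)/\mathrm W_{-n-1}\xrightarrow{\sim}\bigoplus_{m\le n}\mathrm H^1(\Gamma)^{\otimes m}$ induce an isomorphism \[\widehat{\mathbb Q}\pi_1(\Gamma;u,v):=\varprojlim_n\mathbb Q\pi_1(\Gamma;u,v)/\mathrm W_{-n-1}\xrightarrow{\sim}\prod_{m\ge0}\mathrm H^1(\Gamma)^{\otimes m}.\]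
   Context: A graph consists of finite sets of vertices $V$, oriented edges $E$ and half-edges $D$, a source map $s\colon E\sqcup D\to V$, and a fixed-point-free involution $e\mapsto e^{-1}$ on $E$, with $t(e):=s(e^{-1})$; graphs are nonempty and connected. A rationally metrised graph also has lengths $\ell\colon E\to\mathbb Q_{>0}$ with $\ell(e^{-1})=\ell(e)$. $\pi_1(\Gamma;u,v)$ is the set of homotopy classes of paths from $u$ to $v$, composition written right to left ($\gamma'\gamma$ means $\gamma$ then $\gamma'$), and $\mathbb Q\pi_1(\Gamma;u,v)$ the $\mathbb Q$-vector space on it. $\mathbb Q\cdot E^{\pm}$ is the $\mathbb Q$-span of edges modulo $e^{-1}=-e$, with pairing $\int_e e'=\pm\ell(e)$ if $e'=e^{\pm1}$ and $0$ otherwise; $\mathrm H_1(\Gamma)=\mathrm H_1(\Gamma,\mathbb Q)\subset\mathbb Q\cdot E^\pm$ with the restricted (cycle) pairing, $\mathrm H^1(\Gamma)=\mathrm{Hom}(\mathrm H_1(\Gamma),\mathbb Q)$. The higher cycle pairing $\int_\gamma\omega_1\cdots\omega_n$ for $\omega_i\in\mathrm H_1(\Gamma)$ is defined by: for the constant path, $1$ if $n=0$ and $0$ otherwise; for an edge, $\int_e\omega_1\cdots\omega_n=\frac1{n!}\prod_i\int_e\omega_i$; and $\int_{e\gamma}\omega_1\cdots\omega_n=\sum_{i=0}^n\int_e\omega_{i+1}\cdots\omega_n\cdot\int_\gamma\omega_1\cdots\omega_i$ when $s(e)=t(\gamma)$; extended bilinearly (it is well-defined on homotopy classes). $\bigoplus_{m\le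 n}\mathrm H_1(\Gamma)^{\otimes m}$ is the part of tensor length $\le n$ of the shuffle algebra; $\mathrm H^1(\Gamma)^{\otimes m}$ is dual to $\mathrm H_1(\Gamma)^{\otimes m}$. *)

(* Defs.v *)
From HB Require Import structures.
From mathcomp Require Import all_boot all_order all_algebra.
From Stdlib Require Import Relation_Operators.
From Stdlib Require List.
Set Implicit Arguments. Unset Strict Implicit. Unset Printing Implicit Defensive.
Import Order.TTheory GRing.Theory Num.Theory.
Local Open Scope ring_scope.

Record rmgraph := RMGraph {
  V : finType;
  E : finType;
  D : finType;                       (* half-edges (legs) *)
  src : E + D -> V;
  einv : E -> E;
  len : E -> rat;
  einvK : forall e, einv (einv e) = e;
  einv_nofix : forall e, einv e != e;
  len_pos : forall e, 0 < len e;
  len_inv : forall e, len (einv e) = len e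
}.

Section Graph.
Variable G : rmgraph.
Local Notation V := (V G).
Local Notation E := (E G).

Definition s (e : E) : V := @src G (inl e).
Definition t (e : E) : V := s (@einv G e).

(* A path is the sequence of its edges, in the order of traversal
   (first traversed edge first).  [is_path u v p]: p goes from u to v. *)
Definition is_path (u v : V) (p : seq E) : bool :=
  match p with
  | [::] => u == v
  | e :: p' => [&& s e == u, path (fun e1 e2 => t e1 == s e2) e p'
                 & t (last e p') == v]
  end.

Definition htpy_step (u v : V) (p q : seq E) : Prop :=
  [/\ is_path u v p, is_path u v q &
      exists a b e, p = a ++ e :: @einv G e :: b /\ q = a ++ b].

Definition homotopic (u v : V) : seq E -> seq E -> Prop :=
  clos_refl_sym_trans (seq E) (htpy_step u v).

Definition comb := seq (rat * seq E).
Definition coef (x : comb) (p : seq E) : rat := \sum_(a <- x | a.2 == p) a.1.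
Definition valid (u v : V) (x : comb) : bool := all (fun a => is_path u v a.2) x.
Definition csub (x y : comb) : comb := x ++ [seq (- a.1, a.2) | a <- y].
Definition aug (x : comb) : rat := \sum_(a <- x) a.1.
(* product in the fundamental groupoid algebra, composition right to left:
   x * y means "first y, then x", i.e. concatenation (q ++ p). *)
Definition cmul (x y : comb) : comb :=
  [seq (a.1 * b.1, b.2 ++ a.2) | a <- x, b <- y].

(* x represents 0 in Q pi_1(G;u,v) = Q[paths u->v] / span{p - q | p ~ q}. *)
Definition null_Qpi (u v : V) (x : comb) : Prop :=
  exists r : seq (rat * seq E * seq E),
    (forall a, a \in r -> [/\ is_path u v a.1.2, is_path u v a.2 &
                             homotopic u v a.1.2 a.2]) /\
    forall p, coef x p = \sum_(a <- r) a.1.1 * ((a.1.2 == p)%:R - (a.2 == p)%:R).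

Definition eq_Qpi (u v : V) (x y : comb) : Prop := null_Qpi u v (csub x y).

(* J = augmentation ideal of Q pi_1(G,u): classes of loops at u with
   coefficient sum 0.  W_{-k} = Q pi_1(G;u,v) . J^k, i.e. x lies in W_{-k}
   iff its class is a finite sum of products a . j_1 ... j_k with
   a in Q pi_1(G;u,v) and j_i in J. *)
Definition inJ (u : V) (j : comb) : bool := valid u u j && (aug j == 0).

Definition inW (u v : V) (k : nat) (x : comb) : Prop :=
  exists terms : seq (comb * seq comb),
    (forall tm, tm \in terms ->
       [/\ valid u v tm.1, size tm.2 = k & all (inJ u) tm.2]) /\
    eq_Qpi u v x (flatten [seq foldl cmul tm.1 tm.2 | tm <- terms]).

(* Q.E^{+-} is modelled as functions w : E -> Q with w(e^{-1}) = -w(e)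
   (the edge e corresponds to w with w(e)=1, w(e^{-1})=-1, 0 elsewhere);
   then int_e w = len e * w e. *)
Definition antisym (w : E -> rat) : Prop := forall e, w (@einv G e) = - w e.
Definition is_cycle (w : E -> rat) : Prop :=
  antisym w /\ forall x : V, \sum_(e | s e == x) w e = 0.

(* Tensors of degree m: functions on sequences of edges (of length m),
   i.e. elements of (Q.E^{+-})^{(x) m} viewed in Q^{E^m}. *)
Definition tensor := seq E -> rat.
Definition pure (ws : seq (E -> rat)) : tensor := fun es =>
  if size es == size ws then \prod_(k <- zip ws es) k.1 k.2 else 0.

Definition H1T (m : nat) (T : tensor) : Prop :=
  exists r : seq (rat * seq (E -> rat)),
    (forall a, List.In a r -> size a.2 = m /\ forall w, List.In w a.2 -> is_cycle w) /\
    forall es, T es = \sum_(a <- r) a.1 * pure a.2 es.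

(* Higher cycle pairing, extended linearly to tensors:
   int_{e gamma} T = sum_i (int_e of last m-i slots) * int_gamma (first i slots).
   [Irev r m T] with r the path in reverse order (last traversed edge first). *)
Fixpoint Irev (r : seq E) (m : nat) (T : tensor) : rat :=
  match r with
  | [::] => if m == 0%N then T [::] else 0
  | e :: r' => \sum_(i < m.+1)
       (@len G e ^+ (m - i) / ((m - i)`!)%:R) *
       Irev r' i (fun es => T (es ++ nseq (m - i) e))
  end.

Definition cpair (p : seq E) (m : nat) (T : tensor) : rat := Irev (rev p) m T.
Definition cpair_comb (x : comb) (m : nat) (T : tensor) : rat :=
  \sum_(a <- x) a.1 * cpair a.2 m T.

(* Elements of H^1(G)^{(x) m} = Hom(H_1(G)^{(x) m}, Q): functionals linear
   on H1T m (only their restriction to H1T m matters). *)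
Definition lin_on (m : nat) (phi : tensor -> rat) : Prop :=
  forall (c : rat) T T', H1T m T -> H1T m T' ->
    phi (fun es => c * T es + T' es) = c * phi T + phi T'.

(* Elements of the inverse limit lim_n Q pi_1 / W_{-n-1}: compatible
   sequences of representatives x_n of classes mod W_{-n-1}. *)
Definition compatible (u v : V) (x : nat -> comb) : Prop :=
  (forall n, valid u v (x n)) /\
  forall n, inW u v n.+1 (csub (x n.+1) (x n)).

Definition lim_eq (u v : V) (x y : nat -> comb) : Prop :=
  forall n, inW u v n.+1 (csub (x n) (y n)).

End Graph.

Definition connected (G : rmgraph) : Prop :=
  forall u v : V G, exists p, is_path u v p.

(* Main.v *)
Require Import Defs.
From HB Require Import structures.
From mathcomp Require Import all_boot all_order all_algebra.
From mathcomp Require Import finmap ring.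
From mathcomp.multinomials Require Import monalg.
From Stdlib Require Import Relation_Operators FunctionalExtensionality.
Set Implicit Arguments. Unset Strict Implicit. Unset Printing Implicit Defensive.
Import Order.TTheory GRing.Theory Num.Theory.
Local Open Scope ring_scope.

(* The cycle pairing is positive definite, so H_1 has a basis (om_i) with a dual
   basis (oms_i).  The signature of a path lists its pairings with all words in
   the om_i; composition of paths becomes the convolution dual to deconcatenation,
   and the signature of e e^{-1} is trivial by the binomial theorem.

   Fix paths tau_x from u to every vertex x.  Every path p from u is homotopic to
   the product of the loops tau_(s e) e tau_(t e)^{-1} over the edges e of p,
   followed by tau_v; hence modulo J^2 a loop minus 1 depends only on its 1-chain,
   and the elements g_i = 1/2 sum_e oms_i(e) (tau_(s e) e tau_(t e)^{-1} - 1)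
   of J are dual to the om_i and span J/J^2.  The products g_I . tau_v over the
   words I of length k then span W_{-k}/W_{-k-1}, while their signatures vanish
   below length k and are the Kronecker delta at length k.  The pairing is thus
   unitriangular with respect to word length, which gives all the claims. *)

(** * Convolution of functions on words *)

Section Deconcatenation.
Variables (R : comNzRingType) (T : Type).
Implicit Types (f g h : seq T -> R) (w : seq T).

(** Cutting the word at position [i] matches the composition rule of the higher cycle pairing, with
    [f] for the path traversed first. *)
Definition conv f g w : R :=
  \sum_(i < (size w).+1) f (take i w) * g (drop i w).

Lemma conv_nil f g : conv f g [::] = f [::] * g [::].
Proof. by rewrite /conv big_ord_recl big_ord0 addr0. Qed.

Lemma conv_cons f g x w :
  conv f g (x :: w) = f [::] * g (x :: w) + conv (fun w' => f (x :: w')) g w.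
Proof. by rewrite /conv big_ord_recl. Qed.

Lemma eq_conv f f' g g' : f =1 f' -> g =1 g' -> conv f g =1 conv f' g'.
Proof. by move=> ef eg w; apply: eq_bigr => i _; rewrite ef eg. Qed.

Lemma conv_suml I (r : seq I) (c : I -> R) (F : I -> seq T -> R) g w :
  conv (fun w' => \sum_(i <- r) c i * F i w') g w
  = \sum_(i <- r) c i * conv (F i) g w.
Proof.
rewrite /conv; under eq_bigr => k _ do rewrite mulr_suml.
rewrite exchange_big; apply: eq_bigr => i _; rewrite mulr_sumr.
by apply: eq_bigr => k _; rewrite mulrA.
Qed.

Lemma conv_sumr I (r : seq I) (c : I -> R) (F : I -> seq T -> R) f w :
  conv f (fun w' => \sum_(i <- r) c i * F i w') w
  = \sum_(i <- r) c i * conv f (F i) w.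
Proof.
rewrite /conv; under eq_bigr => k _ do rewrite mulr_sumr.
rewrite exchange_big; apply: eq_bigr => i _; rewrite mulr_sumr.
by apply: eq_bigr => k _; rewrite mulrCA.
Qed.

Lemma conv_linl c f f' g w :
  conv (fun w' => c * f w' + f' w') g w = c * conv f g w + conv f' g w.
Proof.
rewrite /conv mulr_sumr -big_split; apply: eq_bigr => i _ /=.
by rewrite mulrDl mulrA.
Qed.

(** Removing the first letter replaces [f] by its shift [f (x :: _)], so the induction on the word
    generalises over [f]. *)
Lemma conv_assoc f g h : conv (conv f g) h =1 conv f (conv g h).
Proof.
move=> w; elim: w f => [|x w IHw] f; first by rewrite !conv_nil mulrA.
rewrite !conv_cons conv_nil -IHw mulrDr mulrA -addrA; congr (_ + _).
by rewrite -conv_linl; apply: eq_conv => // w'; rewrite conv_cons.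
Qed.

Definition unit_word w : R := (size w == 0)%:R.

Lemma conv1w g : conv unit_word g =1 g.
Proof.
move=> w; rewrite /conv big_ord_recl /= take0 drop0 /unit_word mul1r.
by rewrite big1 ?addr0 // => i _; rewrite size_takel ?ltn_ord // mul0r.
Qed.

Lemma convw1 f : conv f unit_word =1 f.
Proof.
move=> w; rewrite /conv big_ord_recr /= take_size drop_size /unit_word mulr1.
rewrite big1 ?add0r // => i _; rewrite size_drop subn_eq0.
by rewrite leqNgt ltn_ord mulr0.
Qed.

(** In every cut of [w] either the prefix is shorter than [k] or the suffix is shorter than [l]. *)
Lemma conv_low f g k l w :
  (forall w', (size w' < k)%N -> f w' = 0) ->
  (forall w', (size w' < l)%N -> g w' = 0) ->
  (size w < k + l)%N -> conv f g w = 0.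
Proof.
move=> f0 g0 sw; rewrite /conv big1 // => i _.
have lei : (i <= size w)%N by rewrite -ltnS.
have [ltik|leki] := ltnP i k; first by rewrite f0 ?mul0r // size_takel.
rewrite [g _]g0 ?mulr0 // size_drop; rewrite ltn_subLR //.
by apply: leq_trans sw _; rewrite leq_add2r.
Qed.

End Deconcatenation.

(** * Exponentials on words and their inverses *)

Section WordExponential.
Variables (R : numFieldType) (T : Type).

(** The exponential, with respect to [conv], of the function equal to [x] on one-letter words and
    zero elsewhere. *)
Definition word_exp (x : T -> R) (w : seq T) : R :=
  (\prod_(i <- w) x i) / ((size w)`!)%:R.

(** On a word of length [m] all cuts carry the same product of letters up to sign, and the
    coefficients sum to [(1 - 1) ^+ m]. *)
Lemma conv_word_expN (x : T -> R) :
  conv (word_exp x) (word_exp (fun i => - x i)) =1 @unit_word R T.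
Proof.
move=> w; set m := size w.
have fact_neq0 k : (k`!%:R : R) != 0 by rewrite pnatr_eq0 -lt0n fact_gt0.
transitivity ((\prod_(i <- w) x i) / (m`!)%:R * (1 - 1) ^+ m : R); last first.
  rewrite subrr /unit_word -/m expr0n.
  have [m0|_] := eqVneq m 0%N; last by rewrite mulr0.
  by rewrite (size0nil m0) big_nil m0 divr1 mulr1.
rewrite addrC exprDn mulr_sumr /conv -/m; apply: eq_bigr => -[i /=].
rewrite ltnS => leim _; rewrite /word_exp size_takel // size_drop -/m.
have -> : \prod_(j <- drop i w) - x j
          = (-1) ^+ (m - i) * \prod_(j <- drop i w) x j.
  rewrite (eq_bigr (fun j => -1 * x j)) => [|j _]; last by rewrite mulN1r.
  by rewrite big_split /= big_const_seq count_predT iter_mulr_1 size_drop.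
rewrite -{3}(cat_take_drop i w) big_cat /= expr1n mulr1.
have -> : (m`!%:R : R) = ('C(m, i))%:R * (i`!%:R * (m - i)`!%:R).
  by rewrite -!natrM bin_fact.
have := fact_neq0 i; have := fact_neq0 (m - i)%N.
have : ('C(m, i)%:R : R) != 0 by rewrite pnatr_eq0 -lt0n bin_gt0.
move=> ? ? ?; rewrite -mulr_natr; field.
by apply/and3P.
Qed.

End WordExponential.

(** * Signatures of paths and their homotopy invariance *)

Section Signature.
Variable G : rmgraph.
Local Notation E := (E G).

Lemma eq_Irev (r : seq E) m (T T' : tensor G) :
  T =1 T' -> Irev r m T = Irev r m T'.
Proof.
elim: r m T T' => [|e r IHr] m T T' eT /=; first by rewrite eT.
by apply: eq_bigr => i _; congr (_ * _); apply: IHr.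
Qed.

Lemma Irev_sum I (J : seq I) (c : I -> rat) (F : I -> tensor G) (r : seq E) m :
  Irev r m (fun es => \sum_(i <- J) c i * F i es)
  = \sum_(i <- J) c i * Irev r m (F i).
Proof.
elim: r m F => [|e r IHr] m F /=.
  by case: eqP => // _; rewrite big1 // => i _; rewrite mulr0.
under eq_bigr => k _ do rewrite IHr mulr_sumr.
rewrite exchange_big; apply: eq_bigr => i _; rewrite mulr_sumr.
by apply: eq_bigr => k _; rewrite mulrCA.
Qed.

Lemma Irev_scale c (F : tensor G) (r : seq E) m :
  Irev r m (fun es => c * F es) = c * Irev r m F.
Proof.
have := Irev_sum (I := unit) [:: tt] (fun=> c) (fun=> F) r m.
by rewrite big_seq1 => <-; apply: eq_Irev => es; rewrite big_seq1.
Qed.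

Lemma pure_size (ws : seq (E -> rat)) es : size es != size ws -> pure ws es = 0.
Proof. by rewrite /pure => /negPf ->. Qed.

Lemma pure_cons (w : E -> rat) ws e es :
  pure (w :: ws) (e :: es) = w e * pure ws es.
Proof.
by rewrite /pure /= eqSS; case: eqP; rewrite ?mulr0 // big_cons.
Qed.

(** The last edge is integrated by filling the trailing slots of a tensor with copies of it; on a
    pure tensor this splits off a scalar and leaves a shorter pure tensor for the rest of the
    path. *)
Lemma pure_cat_nseq (ws : seq (E -> rat)) i (e : E) es :
  (i <= size ws)%N ->
  pure ws (es ++ nseq (size ws - i) e)
  = (\prod_(w <- drop i ws) w e) * pure (take i ws) es.
Proof.
elim: ws i es => [|w ws IHws] [|i] [|e' es] //= lei; rewrite ?cats0.
- by rewrite big_nil mul1r.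
- by rewrite big_nil mul1r.
- rewrite pure_cons; have := IHws 0%N [::] (leq0n _).
  rewrite /= subn0 => ->; rewrite drop0 big_cons take0.
  by rewrite mulrA.
- rewrite [pure [::] _]pure_size // mulr0 pure_size //=.
  by rewrite eqSS size_cat /= size_nseq -[X in _ != X]add0n -addSnnS eqn_add2r.
- rewrite [pure (_ :: _) [::]]pure_size // mulr0 pure_size //=.
  by rewrite size_nseq subSS ltn_eqF // ltnS leq_subr.
- by rewrite subSS !pure_cons IHws // mulrCA.
Qed.

Variables (T : Type) (om : T -> E -> rat).

Definition signature (p : seq E) (I : seq T) : rat :=
  cpair p (size I) (pure (map om I)).

Definition edge_exp (e : E) : seq T -> rat :=
  word_exp (fun i => len e * om i e).

Lemma signature_nil : signature [::] =1 @unit_word _ T.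
Proof.
case=> [|i I]; rewrite /signature /cpair /rev /= /unit_word //.
by rewrite /pure /= big_nil.
Qed.

(** This is the recursive clause of [Irev], with the power of [len e] and the factorial absorbed
    into [edge_exp]. *)
Lemma signature_rcons p e :
  signature (rcons p e) =1 conv (signature p) (edge_exp e).
Proof.
move=> I; rewrite /signature /cpair rev_rcons /=; apply: eq_bigr => -[i /=].
rewrite ltnS => lei _; rewrite size_takel //.
have -> : Irev (rev p) i
    (fun es => pure (map om I) (es ++ nseq (size I - i) e))
  = Irev (rev p) i (fun es => (\prod_(w <- drop i (map om I)) w e)
      * pure (take i (map om I)) es).
  by apply: eq_Irev => es; rewrite -(size_map om I) pure_cat_nseq // size_map.
rewrite Irev_scale mulrA mulrC -map_take; congr (_ * _).
rewrite /edge_exp /word_exp size_drop -map_drop big_map big_split /=.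
by rewrite big_const_seq count_predT iter_mulr_1 size_drop mulrAC.
Qed.

(** Appending the edges of [q] one at a time reduces this to associativity of [conv]. *)
Lemma signature_cat p q : signature (p ++ q) =1 conv (signature p) (signature q).
Proof.
elim/last_ind: q => [|q e IHq] I.
  rewrite cats0 -{1}[signature p I]convw1.
  by apply: eq_conv => // J; rewrite signature_nil.
rewrite -rcons_cat signature_rcons.
rewrite (eq_conv IHq (fun _ => erefl)) conv_assoc; apply: eq_conv => // J.
by rewrite signature_rcons.
Qed.

Lemma signature0 p : signature p [::] = 1.
Proof.
elim/last_ind: p => [|q e IHq]; first by rewrite signature_nil.
by rewrite signature_rcons conv_nil IHq /edge_exp /word_exp big_nil divr1.
Qed.

Lemma signature1 p i : signature p [:: i] = \sum_(e <- p) len e * om i e.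
Proof.
elim/last_ind: p => [|p e IHp]; first by rewrite signature_nil big_nil.
rewrite signature_rcons conv_cons conv_nil IHp signature0 mul1r -cats1 big_cat big_seq1.
by rewrite /edge_exp /word_exp big_seq1 big_nil !divr1 addrC.
Qed.

Hypothesis om_antisym : forall i, antisym (om i).

(** Multiplicativity isolates the factor of [e] followed by [einv e]; their exponents are opposite
    because the lengths agree and the forms are antisymmetric. *)
Lemma signature_spur p e q : signature (p ++ e :: einv e :: q) =1 signature (p ++ q).
Proof.
move=> I; rewrite signature_cat [RHS]signature_cat; apply: eq_conv => // J.
rewrite -[e :: _]/([:: e; einv e] ++ q) signature_cat -[RHS]conv1w.
apply: eq_conv => // K.
rewrite -[[:: e; _]]/(rcons (rcons [::] e) (einv e)) signature_rcons.
rewrite -(conv_word_expN (fun i => len e * om i e)).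
apply: eq_conv => L.
  rewrite signature_rcons -[RHS]conv1w; apply: eq_conv => // M.
  exact: signature_nil.
rewrite /edge_exp /word_exp; congr (_ / _); apply: eq_bigr => i _.
by rewrite len_inv om_antisym mulrN.
Qed.

Lemma signature_homotopic u v p q :
  homotopic u v p q -> signature p =1 signature q.
Proof.
elim=> {p q} [p q [_ _ [a [b [e [-> ->]]]]]|//|p q _ IH I|p q r _ IH1 _ IH2 I].
- exact: signature_spur.
- by rewrite IH.
- by rewrite IH1.
Qed.

End Signature.

(** * Paths, inverse paths and homotopies *)

Section Paths.
Variable G : rmgraph.
Local Notation E := (E G).
Local Notation V := (V G).
Implicit Types (u v w : V) (p q r : seq E) (e : E).

Lemma is_path_cons u v e p : is_path u v (e :: p) = (s e == u) && is_path (t e) v p.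
Proof. by case: p => [|f p] //=; rewrite [t e == s f]eq_sym -!andbA. Qed.

Lemma path_nil u : is_path u u [::].
Proof. exact: eqxx. Qed.

Lemma is_path_catP u v p q :
  reflect (exists2 w, is_path u w p & is_path w v q) (is_path u v (p ++ q)).
Proof.
elim: p u => [|e p IHp] u.
  by apply: (iffP idP) => [|[w /eqP ->] //]; exists u => //=.
rewrite cat_cons is_path_cons; apply: (iffP andP) => [[se /IHp[w pw qw]]|[w]].
  by exists w; rewrite // is_path_cons se.
by rewrite is_path_cons => /andP[-> pw] qw; split => //; apply/IHp; exists w.
Qed.

Lemma is_path_cat u w v p q : is_path u w p -> is_path w v q -> is_path u v (p ++ q).
Proof. by move=> pw qw; apply/is_path_catP; exists w. Qed.

Lemma is_path_rcons u v p e : is_path u v (rcons p e) = is_path u (s e) p && (t e == v).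
Proof.
rewrite -cats1; apply/is_path_catP/andP => [[w pw]|[pe te]].
  by rewrite is_path_cons => /andP[/eqP ->].
by exists (s e); rewrite // is_path_cons eqxx.
Qed.

Definition pinv p : seq E := rev (map (@einv G) p).

Lemma t_einv e : t (einv e) = s e.
Proof. by rewrite /t einvK. Qed.

Lemma pinvK p : pinv (pinv p) = p.
Proof.
rewrite /pinv map_rev revK -map_comp -[RHS]map_id; apply: eq_map => e /=.
exact: einvK.
Qed.

Lemma pinv_cat p q : pinv (p ++ q) = pinv q ++ pinv p.
Proof. by rewrite /pinv map_cat rev_cat. Qed.

Lemma is_path_pinv u v p : is_path u v p -> is_path v u (pinv p).
Proof.
elim: p u => [|e p IHp] u; first by rewrite /= eq_sym.
rewrite is_path_cons => /andP[/eqP <- pp].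
by rewrite /pinv /= rev_cons is_path_rcons t_einv eqxx andbT IHp.
Qed.

Lemma homotopic_ctx u w x v a b p q :
  is_path u w a -> is_path x v b -> homotopic w x p q ->
  homotopic u v (a ++ p ++ b) (a ++ q ++ b).
Proof.
move=> pa pb; elim=> {p q} [p q [pp pq [c [d [e [ep eq]]]]]|p|p q _ IH|p q r _ IH1 _ IH2].
- apply: rst_step; split.
  + exact: is_path_cat pa (is_path_cat pp pb).
  + exact: is_path_cat pa (is_path_cat pq pb).
  + by exists (a ++ c), (d ++ b), e; rewrite ep eq -!catA.
- exact: rst_refl.
- exact: rst_sym.
- exact: rst_trans IH2.
Qed.

(** Cancellation runs from the inside out: the tail contracts by induction, and the remaining spur
    at the first edge is one elementary homotopy. *)
Lemma homotopic_pinv u v p : is_path u v p -> homotopic u u (p ++ pinv p) [::].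
Proof.
elim: p u => [|e p IHp] u pp; first exact: rst_refl.
move: pp; rewrite is_path_cons => /andP[/eqP se pp].
have pe : is_path u (t e) [:: e] by rewrite is_path_cons se eqxx /= eqxx.
have pie : is_path (t e) u [:: einv e] by rewrite is_path_cons t_einv -se /= !eqxx.
apply: (@rst_trans _ _ _ [:: e; einv e]).
  have -> : (e :: p) ++ pinv (e :: p) = [:: e] ++ (p ++ pinv p) ++ [:: einv e].
    by rewrite /pinv /= rev_cons -cats1 catA.
  exact: (homotopic_ctx pe pie (IHp _ pp)).
apply: rst_step; split => //; last by exists [::], [::], e.
  exact: (is_path_cat pe pie).
exact: eqxx.
Qed.

End Paths.

(* The free algebra on T with its basis of words; as a record whose only instance
   is opaque, so that unification never unfolds the construction. *)
Record word_algebra (T : eqType) := WordAlgebra {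
  walg :> algType rat;
  word : seq T -> walg;
  word0 : word [::] = 1;
  word_cat : forall p q, word (p ++ q) = word p * word q;
  wlift : (seq T -> rat) -> {scalar walg};
  wlift_word : forall F p, wlift F (word p) = F p;
  wrep : walg -> seq (rat * seq T);
  wrepK : forall a, \sum_(z <- wrep a) z.1 *: word z.2 = a;
  wrep_supp : forall a z, z \in wrep a -> wlift (fun p => (p == z.2)%:R) a != 0;
  word_ext : forall a b,
    (forall q, wlift (fun p => (p == q)%:R) a = wlift (fun p => (p == q)%:R) b) -> a = b
}.

(** * Construction of the free algebra on words *)

Section FreeAlgebra.
Variable T : choiceType.
Local Notation A := {malg rat[{fmonom T}]}.
Implicit Types (p q : seq T) (a b : A).

Let mword p : A := << FMonom p >>.

Let mword_cat p q : mword (p ++ q) = mword p * mword q.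
Proof.
rewrite malgM_def /mword fgmulUU mulr1; congr (<< _ >>).
by rewrite -[RHS]/(fmmul _ _) fmmulE.
Qed.

Let malg_scalerAr (z : rat) a b : z *: (a * b) = a * (z *: b).
Proof.
(* Scaling by zero shrinks the support, so both products are expanded over the support of [b]. *)
rewrite (malgMEw (fsubset_refl _) (msuppZ_le z b)) malgME scaler_sumr.
apply: eq_bigr => k _; rewrite scaler_sumr; apply: eq_bigr => l _.
apply/malgP => m; rewrite mcoeffZ; set x := mmul k l.
by rewrite [in LHS]mcoeffU [in RHS]mcoeffU mcoeffZ mulrnAr mulrCA.
Qed.

(* [malg] already has a commutative algebra instance, over commutative monoids;
   the alias keeps the noncommutative one from clashing with it. *)
Definition free_word_malg : Type := A.
HB.instance Definition _ := GRing.Lalgebra.on free_word_malg.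
HB.instance Definition _ :=
  GRing.Lalgebra_isAlgebra.Build rat free_word_malg malg_scalerAr.

Definition mlift (F : seq T -> rat) (a : free_word_malg) : rat :=
  \sum_(k <- msupp a) mcoeff k a * F k.

Let mliftEw F (d : {fset {fmonom T}}) a :
  (msupp a `<=` d)%fset -> mlift F a = \sum_(k <- d) a@_k * F k.
Proof. exact: (@mmapEw _ _ _ idfun (F \o @fmonom_val _)). Qed.

Let mlift_is_linear F : scalar (mlift F).
Proof.
move=> z a b; transitivity (mlift F (z *: a) + mlift F b).
  exact: (@mmapD _ _ _ idfun (F \o @fmonom_val _)).
congr (_ + _); rewrite (mliftEw F (msuppZ_le z a)) /mlift mulr_sumr.
by apply: eq_bigr => k _; rewrite mcoeffZ mulrA.
Qed.

HB.instance Definition _ F :=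
  GRing.isLinear.Build rat free_word_malg rat *%R (mlift F) (mlift_is_linear F).

Let mlift_word F p : mlift F (mword p) = F p.
Proof. by rewrite /mlift msuppU1 big_seq_fset1 mcoeffUU mul1r. Qed.

Let mlift_delta a q : mlift (fun p => (p == q)%:R) a = a@_(FMonom q).
Proof.
have -> : a@_(FMonom q) = \sum_(k <- msupp a) a@_k * (fmonom_val k == q)%:R.
  rewrite {1}[a]monalgE raddf_sum; apply: eq_bigr => k _ /=.
  by rewrite mcoeffU fmP mulr_natr.
by [].
Qed.

Definition free_word_algebra : word_algebra T.
Proof.
refine (@WordAlgebra T free_word_malg mword _ mword_cat
  (fun F => mlift F : {scalar free_word_malg}) mlift_word
  (fun a => [seq (a@_k, fmonom_val k) | k <- msupp a]) _ _ _).
- by rewrite /mword -fmoneE.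
- move=> a; rewrite big_map [RHS]monalgE; apply: eq_bigr => k _.
  by apply/malgP => l; rewrite mcoeffZ !mcoeffU fmK mulrnAr mulr1.
- by move=> a z /mapP[k ka ->] /=; rewrite mlift_delta fmK mcoeff_neq0.
- move=> a b ab; apply/malgP => k; rewrite -(fmK k).
  exact: etrans (esym (mlift_delta a k)) (etrans (ab k) (mlift_delta b k)).
Qed.

End FreeAlgebra.

(** * The path algebra and its filtration by powers of the augmentation ideal *)

Section PathAlgebra.
Variable G : rmgraph.
Local Notation E := (E G).
Local Notation V := (V G).
Local Notation A := (free_word_algebra E).
Local Notation lift := (@wlift _ A).
Implicit Types (u v w : V) (p q r : seq E) (e : E) (a b c : A) (x y : comb G).

Definition pth : seq E -> A := @word _ A.

Lemma pth0 : pth [::] = 1.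
Proof. exact: word0. Qed.

Lemma pth_cat p q : pth (p ++ q) = pth p * pth q.
Proof. exact: word_cat. Qed.

Definition ev x : A := \sum_(z <- x) z.1 *: pth z.2.

Lemma ev_cat x y : ev (x ++ y) = ev x + ev y.
Proof. exact: big_cat. Qed.

Lemma ev_csub x y : ev (csub x y) = ev x - ev y.
Proof.
rewrite ev_cat; congr (_ + _); rewrite /ev big_map -sumrN.
by apply: eq_bigr => z _; rewrite scaleNr.
Qed.

(** The factors swap because [cmul] composes right to left while words multiply in the order of
    traversal. *)
Lemma ev_cmul x y : ev (cmul x y) = ev y * ev x.
Proof.
rewrite /ev /cmul big_allpairs_dep mulr_sumr; apply: eq_bigr => z _.
rewrite mulr_suml; apply: eq_bigr => z' _ /=.
by rewrite pth_cat -scalerAl -scalerAr scalerA mulrC.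
Qed.

Lemma lift_ev F x : lift F (ev x) = \sum_(z <- x) z.1 * F z.2.
Proof.
by rewrite /ev raddf_sum; apply: eq_bigr => z _; rewrite /= linearZ /= wlift_word.
Qed.

Definition pcoef q : {scalar A} := lift (fun p => (p == q)%:R).

Lemma pcoef_pth q p : pcoef q (pth p) = (p == q)%:R.
Proof. exact: wlift_word. Qed.

Lemma pcoef_ev x p : pcoef p (ev x) = coef x p.
Proof.
rewrite /pcoef lift_ev /coef [RHS]big_mkcond; apply: eq_bigr => z _ /=.
by case: eqP; rewrite ?mulr1 ?mulr0.
Qed.

Definition comb_of a : comb G := wrep a.

Lemma comb_ofK a : ev (comb_of a) = a.
Proof. exact: wrepK. Qed.

(* W_{-k}: words are read in the order of traversal, so the factors from the
   augmentation ideal stand on the left. *)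
Inductive Wk u v : nat -> A -> Prop :=
| Wk_path p : is_path u v p -> Wk u v 0 (pth p)
| Wk_mul k p a : is_path u u p -> Wk u v k a -> Wk u v k.+1 ((pth p - 1) * a)
| Wk_htpy k p q : is_path u v p -> is_path u v q -> homotopic u v p q ->
    Wk u v k (pth p - pth q)
| Wk_0 k : Wk u v k 0
| Wk_lin k z a b : Wk u v k a -> Wk u v k b -> Wk u v k (z *: a + b).

Lemma Wk_scale u v k z a : Wk u v k a -> Wk u v k (z *: a).
Proof. by move=> Wa; rewrite -[_ *: _]addr0; apply: Wk_lin => //; apply: Wk_0. Qed.

Lemma Wk_add u v k a b : Wk u v k a -> Wk u v k b -> Wk u v k (a + b).
Proof. by move=> Wa Wb; rewrite -[a]scale1r; apply: Wk_lin. Qed.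

Lemma Wk_opp u v k a : Wk u v k a -> Wk u v k (- a).
Proof. by rewrite -scaleN1r; apply: Wk_scale. Qed.

Lemma Wk_sub u v k a b : Wk u v k a -> Wk u v k b -> Wk u v k (a - b).
Proof. by move=> Wa Wb; apply: Wk_add => //; apply: Wk_opp. Qed.

Lemma Wk_sum u v k (I : eqType) (r : seq I) (F : I -> A) :
  (forall i, i \in r -> Wk u v k (F i)) -> Wk u v k (\sum_(i <- r) F i).
Proof.
move=> WF; rewrite big_seq; elim/big_rec: _ => [|i a ir Wa]; first exact: Wk_0.
by apply: Wk_add => //; apply: WF.
Qed.

(** The product vanishes modulo homotopy, hence lies in every level [l]. A factor [r - 1] of [a] is
    absorbed by [(p - q)(r - 1) = (pr - qr) - (p - q)]. *)
Lemma Wk_htpyM u v k l p q a :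
  is_path u u p -> is_path u u q -> homotopic u u p q -> Wk u v k a ->
  Wk u v l ((pth p - pth q) * a).
Proof.
move=> pp pq hpq Wa; elim: Wa p q pp pq hpq => {k a}
  [r pr|k r a pr _ IHa|k r r' pr pr' _|k|k z a b _ IHa _ IHb] p q pp pq hpq.
- rewrite mulrBl -!pth_cat; apply: Wk_htpy; rewrite ?(is_path_cat _ pr) //.
  have u0 : is_path u u [::] by rewrite /= eqxx.
  exact: (homotopic_ctx u0 pr hpq).
- rewrite mulrA mulrBr mulr1 mulrBl -mulrBl mulrBl [in X in X - _]mulrBl -!pth_cat.
  apply: Wk_sub; last exact: IHa.
  have u0 : is_path u u [::] by rewrite /= eqxx.
  by apply: IHa (homotopic_ctx u0 pr hpq); rewrite (is_path_cat _ pr).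
- rewrite mulrBr !mulrBl -!pth_cat; have u0 : is_path u u [::] by rewrite /= eqxx.
  apply: Wk_sub; apply: Wk_htpy; rewrite ?(is_path_cat _ pr) ?(is_path_cat _ pr') //.
    exact: (homotopic_ctx u0 pr hpq).
  exact: (homotopic_ctx u0 pr' hpq).
- by rewrite mulr0; apply: Wk_0.
- by rewrite mulrDr -scalerAr; apply: Wk_lin; [apply: IHa|apply: IHb].
Qed.

(** The augmentation ideal absorbs loops on the left: [p (r - 1) = (pr - 1) - (p - 1)]. *)
Lemma Wk_loopM u v k p a : is_path u u p -> Wk u v k a -> Wk u v k (pth p * a).
Proof.
move=> pp; elim=> {k a} [r pr|k r a pr Wa IHa|k r r' pr pr' hr|k|k z a b _ IHa _ IHb].
- by rewrite -pth_cat; apply: Wk_path; apply: is_path_cat pr.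
- have -> : pth p * ((pth r - 1) * a) = (pth (p ++ r) - 1) * a - (pth p - 1) * a.
    by rewrite pth_cat mulrA mulrBr mulr1 !mulrBl mul1r opprB addrA subrK.
  by apply: Wk_sub; apply: Wk_mul => //; apply: is_path_cat pr.
- rewrite mulrBr -!pth_cat; apply: Wk_htpy; rewrite ?(is_path_cat pp) //.
  have v0 : is_path v v [::] by rewrite /= eqxx.
  by have := homotopic_ctx pp v0 hr; rewrite !cats0.
- by rewrite mulr0; apply: Wk_0.
- by rewrite mulrDr -scalerAr; apply: Wk_lin.
Qed.

Lemma Wk_pred u v k a : Wk u v k a -> Wk u v k.-1 a.
Proof.
elim=> {k a} [r pr|k r a pr Wa IHa|k r r' pr pr' hr|k|k z a b _ IHa _ IHb].
- exact: Wk_path.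
- by rewrite mulrBl mul1r; apply: Wk_sub => //; apply: Wk_loopM.
- exact: Wk_htpy.
- exact: Wk_0.
- exact: Wk_lin.
Qed.

Lemma Wk_le u v k l a : (l <= k)%N -> Wk u v k a -> Wk u v l a.
Proof.
move=> /subnK <-; elim: (k - l)%N => [|d IHd] //.
by rewrite addSn => /Wk_pred /IHd.
Qed.

Lemma Wk_M u v k l a b : Wk u u k a -> Wk u v l b -> Wk u v (k + l) (a * b).
Proof.
move=> Wa Wb; elim: Wa => {k a}
  [r pr|k r a pr Wa IHa|k r r' pr pr' hr|k|k z a b' _ IHa _ IHb].
- exact: Wk_loopM.
- by rewrite -mulrA; apply: Wk_mul.
- exact: Wk_htpyM Wb.
- by rewrite mul0r; apply: Wk_0.
- by rewrite mulrDl -scalerAl; apply: Wk_lin.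
Qed.

Definition Null u v a : Prop :=
  exists2 r : seq (rat * seq E * seq E),
    (forall z, z \in r -> [/\ is_path u v z.1.2, is_path u v z.2 &
                             homotopic u v z.1.2 z.2]) &
    a = \sum_(z <- r) z.1.1 *: (pth z.1.2 - pth z.2).

Lemma null_QpiE u v x : null_Qpi u v x <-> Null u v (ev x).
Proof.
split=> [[r [rP rE]]|[r rP rE]]; exists r; rewrite //.
  apply: word_ext => p; rewrite -/(pcoef p) pcoef_ev rE raddf_sum.
  by apply: eq_bigr => z _; rewrite /= linearZ linearB /= !pcoef_pth.
split=> // p; rewrite -pcoef_ev rE raddf_sum; apply: eq_bigr => z _.
by rewrite /= linearZ linearB /= !pcoef_pth.
Qed.

Lemma Null_lin u v z a b : Null u v a -> Null u v b -> Null u v (z *: a + b).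
Proof.
move=> [r rP ->] [r' rP' ->]; exists ([seq (z * i.1.1, i.1.2, i.2) | i <- r] ++ r').
  by move=> i; rewrite mem_cat => /orP[/mapP[j /rP ? ->]|/rP'].
rewrite big_cat big_map scaler_sumr; congr (_ + _); apply: eq_bigr => i _ /=.
by rewrite scalerA.
Qed.

Lemma Null0 u v : Null u v 0.
Proof. by exists [::]; rewrite ?big_nil. Qed.

Lemma Null_loopM u v p a : is_path u u p -> Null u v a -> Null u v (pth p * a).
Proof.
move=> pp [r rP ->]; exists [seq (i.1.1, p ++ i.1.2, p ++ i.2) | i <- r].
  move=> i /mapP[j /rP [p1 p2 h] -> /=]; split; rewrite ?(is_path_cat pp) //.
  have v0 : is_path v v [::] by rewrite /= eqxx.
  by have := homotopic_ctx pp v0 h; rewrite !cats0.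
rewrite big_map mulr_sumr; apply: eq_bigr => i _ /=.
by rewrite -scalerAr mulrBr !pth_cat.
Qed.

Lemma Null_Wk u v k a : Null u v a -> Wk u v k a.
Proof.
move=> [r rP ->]; apply: Wk_sum => z /rP[p1 p2 h].
by apply: Wk_scale; apply: Wk_htpy.
Qed.

Lemma valid_Wk u v x : valid u v x -> Wk u v 0 (ev x).
Proof.
move=> /allP px; apply: Wk_sum => z /px pz.
by apply: Wk_scale; apply: Wk_path.
Qed.

(** Augmentation zero allows 1 to be subtracted from every loop occurring in [x] without changing
    the sum. *)
Lemma inJ_ev u v k x a : inJ u x -> Wk u v k a -> Wk u v k.+1 (ev x * a).
Proof.
move=> /andP[/allP px /eqP ax] Wa.
have -> : ev x = \sum_(z <- x) z.1 *: (pth z.2 - 1).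
  under eq_bigr => z _ do rewrite scalerBr.
  by rewrite sumrB -scaler_suml -[\sum_(i <- x) i.1]/(aug x) ax scale0r subr0.
rewrite mulr_suml; apply: Wk_sum => z /px pz.
by rewrite -scalerAl; apply: Wk_scale; apply: Wk_mul.
Qed.

Lemma inW_Wk u v k x : inW u v k x -> Wk u v k (ev x).
Proof.
move=> [tms [tmP /null_QpiE]]; rewrite ev_csub => /(Null_Wk k) Wd.
rewrite -[ev x](subrK (ev (flatten [seq foldl (@cmul G) tm.1 tm.2 | tm <- tms]))).
apply: Wk_add => // {Wd}; elim: tms tmP => [|tm tms IH] tmP.
  by rewrite /ev big_nil; apply: Wk_0.
rewrite /= ev_cat; apply: Wk_add; last first.
  by apply: IH => tm' tm'in; apply: tmP; rewrite inE tm'in orbT.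
have [va <- aJ] := tmP _ (mem_head _ _); rewrite -[size _]addn0.
(* Each factor multiplies the accumulator of [foldl] and raises its level by one, so the level,
   initially 0, is generalised. *)
elim: tm.2 tm.1 0%N (valid_Wk va) aJ => [|j js IHj] y l Wy //= /andP[jJ jsJ].
by rewrite addSnnS; apply: IHj => //; rewrite ev_cmul; apply: inJ_ev.
Qed.

Lemma inW_evP u v k x : inW u v k x <->
  exists2 tms : seq (comb G * seq (comb G)),
    (forall tm, tm \in tms -> [/\ valid u v tm.1, size tm.2 = k & all (inJ u) tm.2]) &
    Null u v (ev x - ev (flatten [seq foldl (@cmul G) tm.1 tm.2 | tm <- tms])).
Proof.
split=> [[tms [tmP /null_QpiE]]|[tms tmP]].
  by rewrite ev_csub => h; exists tms.
by rewrite -ev_csub => /null_QpiE h; exists tms.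
Qed.

Definition cscale (z : rat) x : comb G := [seq (z * i.1, i.2) | i <- x].

Lemma ev_cscale z x : ev (cscale z x) = z *: ev x.
Proof.
by rewrite /ev big_map scaler_sumr; apply: eq_bigr => i _; rewrite scalerA.
Qed.

Lemma ev_foldl_scale z x js :
  ev (foldl (@cmul G) (cscale z x) js) = z *: ev (foldl (@cmul G) x js).
Proof.
elim/last_ind: js => [|js j IHj] /=; first exact: ev_cscale.
by rewrite -!cats1 !foldl_cat /= !ev_cmul IHj -scalerAr.
Qed.

Lemma ev_flatten_map (I : eqType) (f : I -> comb G) (r : seq I) :
  ev (flatten (map f r)) = \sum_(i <- r) ev (f i).
Proof.
by elim: r => [|i r IH] /=; rewrite ?big_nil ?big_cons ?ev_cat ?IH // /ev big_nil.
Qed.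

(** Lets the later arguments on the filtration proceed by induction on the rules generating [Wk]. *)
Lemma inWE u v k x : inW u v k x <-> Wk u v k (ev x).
Proof.
split=> [|Wx]; first exact: inW_Wk.
apply/inW_evP; move: (ev x) Wx => {x} a; elim=> {k a}
  [p pp|k p a pp _ [tms tmP tmE]|k p q pp pq hpq
  |k|k z a b _ [tms tmP tmE] _ [tms' tmP' tmE']].
- exists [:: ([:: (1, p)], [::])].
    by move=> tm; rewrite inE => /eqP -> /=; rewrite pp.
  by rewrite /= /ev big_seq1 scale1r subrr; apply: Null0.
(* The leftmost factor in traversal order is the last one multiplied in by [foldl]; [p - 1] is
   entered as a combination of augmentation zero. *)
- exists [seq (tm.1, rcons tm.2 [:: (1, p); (-1, [::])]) | tm <- tms].
    move=> tm /mapP[tm' /tmP [va sz aJ] -> /=]; split; rewrite ?size_rcons ?sz //.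
    by rewrite all_rcons aJ andbT /inJ /= pp eqxx /aug big_cons big_seq1 subrr eqxx.
  rewrite -map_comp ev_flatten_map.
  under eq_bigr => tm _ do rewrite /= -cats1 foldl_cat /= ev_cmul.
  rewrite -mulr_sumr -ev_flatten_map /ev big_cons big_seq1 /=.
  rewrite scale1r scaleN1r pth0 -/(ev _).
  rewrite -mulrBr mulrBl mul1r addrC -scaleN1r.
  by apply: Null_lin => //; apply: Null_loopM.
- exists [::] => //=; rewrite /ev big_nil subr0; exists [:: (1, p, q)].
    by move=> z; rewrite inE => /eqP ->.
  by rewrite big_seq1 scale1r.
- by exists [::] => //=; rewrite /ev big_nil subr0; apply: Null0.
- exists ([seq (cscale z tm.1, tm.2) | tm <- tms] ++ tms').
    move=> tm; rewrite mem_cat => /orP[/mapP[tm' /tmP [va sz aJ] -> /=]|/tmP' //].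
    by split => //; rewrite /valid all_map.
  rewrite map_cat flatten_cat ev_cat -map_comp ev_flatten_map.
  under eq_bigr => tm _ do rewrite /= ev_foldl_scale.
  rewrite -scaler_sumr -ev_flatten_map opprD addrACA -scalerBr.
  exact: Null_lin.
Qed.

(** Ensures that the representative [comb_of a] involves only paths from [u] to [v]. It suffices to
    treat level 0, generated by such paths and their differences. *)
Lemma Wk_support u v k a p : Wk u v k a -> pcoef p a != 0 -> is_path u v p.
Proof.
move/(Wk_le (leq0n k)) => {k}; move e0 : 0%N => k Wa; elim: Wa e0 => {k a}
  [r pr _|//|k r r' pr pr' hr _|k _|k z a b _ IHa _ IHb k0].
- by rewrite pcoef_pth; case: (r =P p) => [<-|_]; rewrite ?eqxx.
- rewrite linearB !pcoef_pth; case: (r =P p) => [<- //|_]; case: (r' =P p) => [<- //|_].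
  by rewrite subr0 eqxx.
- by rewrite linear0 eqxx.
- rewrite linearD linearZ /=; have [->|/(IHa k0) -> //] := eqVneq (pcoef p a) 0.
  by rewrite mulr0 add0r; apply: IHb k0.
Qed.

Lemma valid_comb_of u v k a : Wk u v k a -> valid u v (comb_of a).
Proof.
by move=> Wa; apply/allP => z /wrep_supp; apply: (Wk_support Wa).
Qed.

Section Signature.
Variables (T : Type) (om : T -> E -> rat).

Definition asig (I : seq T) : {scalar A} := lift (fun p => signature om p I).

Lemma asig_pth p I : asig I (pth p) = signature om p I.
Proof. exact: wlift_word. Qed.

Lemma asig_1 I : asig I 1 = unit_word rat I.
Proof. by rewrite -pth0 asig_pth signature_nil. Qed.

Lemma asig_M a b I : asig I (a * b) = conv (asig^~ a) (asig^~ b) I.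
Proof.
rewrite -(wrepK a) -(wrepK b) mulr_suml linear_sum.
transitivity (\sum_(x <- wrep a) x.1 * \sum_(y <- wrep b) y.1 *
   conv (signature om x.2) (signature om y.2) I).
  apply: eq_bigr => x _; rewrite -scalerAl linearZ /= mulr_sumr linear_sum.
  congr (_ * _); apply: eq_bigr => y _.
  by rewrite -scalerAr linearZ /= -word_cat asig_pth signature_cat.
transitivity (conv (fun J => \sum_(x <- wrep a) x.1 * signature om x.2 J)
  (fun J => \sum_(y <- wrep b) y.1 * signature om y.2 J) I).
  by rewrite conv_suml; apply: eq_bigr => x _; rewrite conv_sumr.
by apply: eq_conv => J; rewrite linear_sum; apply: eq_bigr => z _;
   rewrite linearZ /= asig_pth.
Qed.

End Signature.

End PathAlgebra.

(** * The cycle space and its dual bases *)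

Section CycleSpace.
Variable G : rmgraph.
Local Notation E := (E G).
Local Notation V := (V G).

(** The cycle pairing; the factor one half compensates for counting each edge in both
    orientations. *)
Definition cycle_form (w w' : E -> rat) : rat :=
  2^-1 * \sum_e len e * w e * w' e.

Let n := #|E|.
Let vec (w : E -> rat) : 'rV[rat]_n := \row_k w (enum_val k).
Let fn (x : 'rV[rat]_n) (e : E) : rat := x 0 (enum_rank e).

Let vecK w : fn (vec w) =1 w.
Proof. by move=> e; rewrite /fn mxE enum_rankK. Qed.

Let sum_enum (F : E -> rat) : \sum_e F e = \sum_(k < n) F (enum_val k).
Proof.
rewrite (reindex_onto enum_val enum_rank) => [|e _]; last exact: enum_rankK.
by apply: eq_bigl => k; rewrite enum_valK eqxx.
Qed.

(** The left kernel is the cycle space: the first block tests antisymmetry, the second the boundary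
    at each vertex. *)
Let K : 'M[rat]_(n, n + #|V|) := row_mx
  (\matrix_(i, j) ((enum_val i == einv (enum_val j))%:R + (i == j)%:R))
  (\matrix_(i, x) (s (enum_val i) == enum_val x)%:R).

Let cycleP (x : 'rV_n) : reflect (is_cycle (fn x)) (x <= kermx K)%MS.
Proof.
have ant (j : 'I_n) : (x *m lsubmx K) 0 j
    = fn x (einv (enum_val j)) + fn x (enum_val j).
  rewrite mxE (eq_bigr (fun k => x 0 k * (enum_val k == einv (enum_val j))%:R
                             + x 0 k * (k == j)%:R)); last first.
    by move=> k _; rewrite row_mxKl mxE mulrDr.
  rewrite big_split /=; congr (_ + _).
    rewrite (bigD1 (enum_rank (einv (enum_val j)))) //= enum_rankK eqxx mulr1.
    rewrite big1 ?addr0 // => k kN; case: eqP => [kE|]; rewrite ?mulr0 //.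
    by rewrite -kE enum_valK eqxx in kN.
  rewrite (bigD1 j) //= eqxx mulr1 big1 ?addr0 /fn ?enum_valK // => k /negPf ->.
  by rewrite mulr0.
have bd (j : 'I_#|V|) : (x *m rsubmx K) 0 j = \sum_(e | s e == enum_val j) fn x e.
  rewrite mxE [RHS]big_mkcond /= sum_enum; apply: eq_bigr => k _.
  by rewrite row_mxKr mxE /fn enum_valK; case: eqP; rewrite ?mulr1 ?mulr0.
have -> : (x <= kermx K)%MS = (x *m lsubmx K == 0) && (x *m rsubmx K == 0).
  by rewrite sub_kermx -row_mx_eq0 -mul_mx_row hsubmxK.
apply: (iffP andP) => [[/eqP xl /eqP xr]|[xa xb]]; split.
- move=> e; apply/eqP; rewrite -addr_eq0; apply/eqP.
  by rewrite -[e]enum_rankK -ant xl mxE.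
- by move=> y; rewrite -[y]enum_rankK -bd xr mxE.
- by apply/eqP/rowP => j; rewrite ant xa addNr mxE.
- by apply/eqP/rowP => j; rewrite bd xb mxE.
Qed.

Let L : 'M[rat]_n := diag_mx (\row_k (2^-1 * len (enum_val k))).
Let B := row_base (kermx K).
(** The Gram matrix of [cycle_form] in the basis of cycles given by the rows of [B]. *)
Let M := B *m L *m B^T.

Let mulL p q (X : 'M_(p, n)) (Y : 'M_(q, n)) i j :
  (X *m L *m Y^T) i j = cycle_form (fn (row i X)) (fn (row j Y)).
Proof.
rewrite /cycle_form mulr_sumr sum_enum mxE; apply: eq_bigr => k _.
rewrite mul_mx_diag !mxE /fn !mxE enum_valK; ring.
Qed.

(** A vector in the kernel gives a cycle whose form with itself is zero; this is a sum of
    nonnegative terms with positive weights, so the cycle vanishes. *)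
Let M_unit : M \in unitmx.
Proof.
rewrite -row_free_unit -kermx_eq0; apply/eqP/row_matrixP => i; rewrite row0.
set x := row i _; have xM : x *m M = 0 by rewrite /x -row_mul mulmx_ker row0.
have xB : x *m B = 0.
  have /rowP/(_ 0) : x *m B *m L *m (x *m B)^T = 0.
    have yM : x *m B *m L *m B^T = 0 by rewrite -xM /M -!mulmxA.
    by rewrite trmx_mul mulmxA yM mul0mx.
  rewrite mulL !row_id [in RHS]mxE.
  rewrite /cycle_form => /eqP; rewrite mulf_eq0 invr_eq0 pnatr_eq0 /= => /eqP s0.
  have t0 e : len e * fn (x *m B) e * fn (x *m B) e = 0.
    have ge0 (f : E) : true -> 0 <= len f * fn (x *m B) f * fn (x *m B) f.
      by move=> _; rewrite -mulrA -expr2 mulr_ge0 ?sqr_ge0 // ltW // len_pos.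
    exact: (psumr_eq0P ge0 s0).
  apply/rowP => k; rewrite [RHS]mxE; have /eqP := t0 (enum_val k).
  by rewrite -mulrA mulf_eq0 gt_eqF ?len_pos //= mulf_eq0 orbb /fn enum_valK => /eqP.
by apply/eqP; rewrite -(mulmx_free_eq0 _ (row_base_free (kermx K))) -/B xB.
Qed.

Let MT : M^T = M.
Proof. by rewrite /M trmx_mul trmxK trmx_mul tr_diag_mx -[RHS]mulmxA. Qed.

Lemma cycle_dual_basis : exists d (om oms : 'I_d -> E -> rat),
  [/\ forall i, is_cycle (om i), forall i, is_cycle (oms i),
      forall w, is_cycle w -> w =1 fun e => \sum_i cycle_form w (oms i) * om i e,
      forall w, is_cycle w -> w =1 fun e => \sum_i cycle_form w (om i) * oms i e
    & forall i j, cycle_form (oms i) (om j) = (i == j)%:R].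
Proof.
(* The inverse Gram matrix turns the basis into its dual basis. *)
pose C := invmx M *m B.
have BLB (x : 'rV_(\rank (kermx K))) : x *m B *m L *m B^T = x *m M.
  by rewrite /M -!mulmxA.
have BK : (B <= kermx K)%MS by rewrite eq_row_base.
(* Used for both expansions, with [X] and [Y] being [C] and [B] in either order. *)
have expand w (X Y : 'M[rat]_(\rank (kermx K), n)) :
    (forall x : 'rV_(\rank (kermx K)), x *m B *m L *m X^T *m Y = x *m B) -> is_cycle w ->
    w =1 fun e => \sum_i cycle_form w (fn (row i X)) * fn (row i Y) e.
  move=> XY wc e; have : (vec w <= kermx K)%MS.
    apply/cycleP; have -> : fn (vec w) = w.
      by apply: functional_extensionality; apply: vecK.
    exact: wc.
  rewrite -(eq_row_base (kermx K)) => /submxP[x xE].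
  rewrite -{1}(vecK w e) xE -(XY x) -xE /fn mxE; apply: eq_bigr => i _.
  rewrite mulL row_id !mxE; congr (_ * _).
  by congr (cycle_form _ _); apply: functional_extensionality; apply: vecK.
exists (\rank (kermx K)), (fun i => fn (row i B)), (fun i => fn (row i C)); split.
- by move=> i; apply/cycleP; apply: submx_trans (row_sub _ _) BK.
- move=> i; apply/cycleP; apply: submx_trans (row_sub _ _) _.
  exact: submx_trans (submxMl _ _) BK.
- move=> w wc; apply: expand => // x.
  by rewrite /C trmx_mul trmx_inv MT [_ *m (B^T *m _)]mulmxA BLB mulmxK.
- move=> w wc; apply: expand => // x.
  by rewrite BLB /C mulmxA mulmxK.
- have CLB : C *m L *m B^T = 1%:M.
    by rewrite -(mulVmx M_unit) {2}/M /C -!mulmxA.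
  by move=> i j; rewrite -mulL CLB mxE.
Qed.

End CycleSpace.

(** * The 1-chains of paths *)

Section Chains.
Variable G : rmgraph.
Local Notation E := (E G).
Local Notation V := (V G).
Implicit Types (p : seq E) (e : E).

Lemma einv_bij : bijective (@einv G).
Proof. by exists (@einv G) => e; rewrite einvK. Qed.

Lemma sum_einv (M : nmodType) (F : E -> M) : \sum_e F (einv e) = \sum_e F e.
Proof. by rewrite [RHS](reindex (@einv G)) //; apply: onW_bij einv_bij. Qed.

Lemma sum_count (M : lmodType rat) (F : E -> M) p :
  \sum_(e <- p) F e = \sum_e (count_mem e p)%:R *: F e.
Proof.
elim: p => [|f p IHp]; first by rewrite big_nil big1 // => e _; rewrite scale0r.
rewrite big_cons IHp [in RHS](eq_bigr (fun e =>
  (f == e)%:R *: F e + (count_mem e p)%:R *: F e)).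
  rewrite big_split /=; congr (_ + _).
  rewrite (bigD1 f) //= eqxx scale1r big1 ?addr0 // => e.
  by rewrite eq_sym => /negPf ->; rewrite scale0r.
by move=> e _; rewrite /= natrD scalerDl.
Qed.

(** The class of the path in the span of edges modulo [e^{-1} = -e], modelled as an antisymmetric
    function. *)
Definition chain p e : rat := (count_mem e p)%:R - (count_mem (einv e) p)%:R.

Lemma chain_antisym p : antisym (chain p).
Proof. by move=> e; rewrite /chain einvK opprB. Qed.

(** The contributions of source and target of each edge telescope along the path. *)
Lemma chain_boundary u v p x : is_path u v p ->
  \sum_(e | s e == x) chain p e = (u == x)%:R - (v == x)%:R.
Proof.
elim: p u => [|f p IHp] u.
  by move=> /eqP ->; rewrite subrr big1 // => e _; rewrite /chain subrr.
rewrite is_path_cons => /andP[/eqP <- /IHp pE].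
have chE e : chain (f :: p) e = ((f == e)%:R - (einv f == e)%:R) + chain p e.
  have -> : (einv f == e) = (f == einv e) by rewrite -(inj_eq (can_inj (@einvK G))) einvK.
  by rewrite /chain /= !natrD opprD addrACA.
rewrite (eq_bigr _ (fun e _ => chE e)) big_split /= pE.
have delta f' : \sum_(e | s e == x) (f' == e)%:R = (s f' == x)%:R :> rat.
  rewrite big_mkcond (bigD1 f') //= eqxx big1 ?addr0; first by case: eqP.
  by move=> e; rewrite eq_sym => /negPf ->; case: ifP.
by rewrite sumrB !delta -/(t f) addrA subrK.
Qed.

Lemma chain_cycle u p : is_path u u p -> is_cycle (chain p).
Proof.
move=> pp; split; first exact: chain_antisym.
by move=> x; rewrite (chain_boundary x pp) subrr.
Qed.

Lemma cycle_form_chain (w : E -> rat) p : antisym w ->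
  cycle_form (chain p) w = \sum_(e <- p) len e * w e.
Proof.
move=> wa; rewrite (@sum_count rat^o) /cycle_form.
pose F e := (count_mem e p)%:R * (len e * w e).
(* Both orientations contribute equally after reindexing by [einv], which cancels the factor one
   half. *)
rewrite (eq_bigr (fun e => F e + F (einv e))) => [|e _]; last first.
  by rewrite /F /chain len_inv wa; ring.
rewrite big_split /= (sum_einv F).
have -> : \sum_e (count_mem e p)%:R *: (len e * w e : rat^o) = \sum_e F e by [].
by field.
Qed.

Lemma sum_pinv (w : E -> rat) (p : seq E) : antisym w ->
  \sum_(e <- pinv p) len e * w e = - \sum_(e <- p) len e * w e.
Proof.
move=> wa; rewrite /pinv (perm_big _ (permEl (perm_rev _))) big_map -sumrN.
by apply: eq_bigr => e _; rewrite len_inv wa mulrN.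
Qed.

(** Grouping the edges by source factors out the boundary of [w]. *)
Lemma sum_cycle_src (w : E -> rat) (h : V -> rat) :
  is_cycle w -> \sum_e w e * h (s e) = 0.
Proof.
move=> [_ wb]; rewrite (partition_big (@s G) xpredT) //= big1 // => x _.
rewrite (eq_bigr (fun e => w e * h x)) => [|e /eqP -> //].
by rewrite -mulr_suml wb mul0r.
Qed.

Lemma sum_cycle_tgt (w : E -> rat) (h : V -> rat) :
  is_cycle w -> \sum_e w e * h (t e) = 0.
Proof.
move=> wc; have [wa _] := wc.
rewrite -sum_einv (eq_bigr (fun e => - (w e * h (s e)))) => [|e _].
  by rewrite sumrN sum_cycle_src // oppr0.
by rewrite wa t_einv mulNr.
Qed.

End Chains.

(** * Generators of the augmentation ideal modulo its square *)

Lemma subr1_mul (R : nzRingType) (a b : R) :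
  a * b - 1 = (a - 1) * (b - 1) + (a - 1) + (b - 1).
Proof.
rewrite mulrBr mulr1 mulrBl mul1r !opprB -[_ + (1 - a) + _]addrA.
by rewrite [1 - a + _]addrA subrK subrr addr0 addrA subrK.
Qed.

(** Bookkeeping for appending an edge to a path: [o] is 1, [b] a product of two loops and [m] the
    quadratic term of its expansion. *)
Lemma telescope_subr (Z : zmodType) (a b c m o x y : Z) :
  b - o = m + a + x -> c - o - (y + x) = (c - b) + m + (a - y).
Proof.
move=> bE; have -> : m = b - o - x - a by rewrite bE addrK addrK.
by rewrite opprD !addrA !subrK addrAC.
Qed.

Section Generators.
Variables (G : rmgraph) (u : V G).
Local Notation E := (E G).
Local Notation V := (V G).
Local Notation A := (free_word_algebra E).
Variable tau : V -> seq E.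
Hypotheses (tauP : forall x, is_path u x (tau x)) (tau_base : tau u = [::]).

Definition tau_loop e : seq E := tau (s e) ++ e :: pinv (tau (t e)).
Local Notation dl e := (pth (tau_loop e) - 1).

Lemma is_path_tau_loop e : is_path u u (tau_loop e).
Proof.
apply: is_path_cat (tauP _) _; rewrite is_path_cons eqxx.
exact: is_path_pinv (tauP _).
Qed.

Lemma pinv_tau_loop e : pinv (tau_loop e) = tau_loop (einv e).
Proof. by rewrite /tau_loop pinv_cat -cat1s pinv_cat pinvK t_einv -catA. Qed.

Lemma Wk_aug (p : seq E) : is_path u u p -> Wk u u 1 (pth p - 1).
Proof.
move=> pp; rewrite -[_ - 1]mulr1; apply: Wk_mul => //.
by rewrite -pth0; apply: Wk_path; apply: path_nil.
Qed.

(** By [subr1_mul], a loop minus 1 is additive under composition modulo the square of the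
    augmentation ideal, so the edges can be split off one by one. *)
Lemma path_tau_loop_Wk2 x (p : seq E) : is_path u x p ->
  Wk u u 2 (pth (p ++ pinv (tau x)) - 1 - \sum_(e <- p) dl e).
Proof.
elim/last_ind: p x => [|p e IHp] x.
  move=> /eqP <-; rewrite tau_base big_nil pth0 subrr subr0; exact: Wk_0.
rewrite is_path_rcons => /andP[pe /eqP <-].
set c := pth _; pose a := p ++ pinv (tau (s e)).
have pa : is_path u u a := is_path_cat pe (is_path_pinv (tauP _)).
have -> : c - 1 - \sum_(f <- rcons p e) dl f =
    (c - pth (a ++ tau_loop e)) + (pth a - 1) * dl e + (pth a - 1 - \sum_(f <- p) dl f).
  rewrite -cats1 big_cat big_seq1 /=; apply: telescope_subr.
  by rewrite pth_cat subr1_mul.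
apply: Wk_add; [apply: Wk_add|exact: IHp].
  apply: Wk_htpy.
  - apply: is_path_cat (is_path_pinv (tauP _)).
    by rewrite is_path_rcons pe eqxx.
  - exact: is_path_cat pa (is_path_tau_loop _).
  - apply: rst_sym; rewrite /a /tau_loop -cats1 -!catA.
    have pr : is_path (s e) u (e :: pinv (tau (t e))).
      by rewrite is_path_cons eqxx (is_path_pinv (tauP _)).
    (* Between [p] and [e] the detour to [u] and back along [tau (s e)] contracts. *)
    have := homotopic_pinv (is_path_pinv (tauP (s e))); rewrite pinvK => h.
    by have := homotopic_ctx pe pr h; rewrite -!catA.
apply: Wk_mul => //; exact: Wk_aug (is_path_tau_loop _).
Qed.

(** The two loops are inverse up to homotopy, so expanding their product minus 1 leaves only the
    quadratic term. *)
Lemma tau_loop_einv_Wk2 e : Wk u u 2 (dl e + dl (einv e)).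
Proof.
have -> : dl e + dl (einv e) =
    (pth (tau_loop e ++ tau_loop (einv e)) - pth [::]) - dl e * dl (einv e).
  have cancel_add (Z : zmodType) (m x y : Z) : m + x + y - m = x + y.
    by rewrite -[m + x + y]addrA [LHS]addrC addKr.
  by rewrite pth0 pth_cat subr1_mul cancel_add.
apply: Wk_sub; last by apply: Wk_mul (is_path_tau_loop _) (Wk_aug (is_path_tau_loop _)).
apply: Wk_htpy; rewrite ?path_nil //.
  exact: is_path_cat (is_path_tau_loop _) (is_path_tau_loop _).
by rewrite -pinv_tau_loop; apply: homotopic_pinv (is_path_tau_loop _).
Qed.

(** Passing from edge counts to half the antisymmetric chain changes the sum by multiples of
    [dl e + dl (einv e)], which are negligible. *)
Lemma loop_chain_Wk2 (p : seq E) : is_path u u p ->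
  Wk u u 2 (pth p - 1 - \sum_e (2^-1 * chain p e) *: dl e).
Proof.
move=> pp; have := path_tau_loop_Wk2 pp; rewrite tau_base cats0 sum_count => Wp.
pose n e : rat := (count_mem e p)%:R.
have -> : \sum_e (2^-1 * chain p e) *: dl e
    = \sum_e n e *: dl e - \sum_e (2^-1 * n e) *: (dl e + dl (einv e)).
  under [X in _ - X]eq_bigr => e _ do rewrite scalerDr.
  rewrite big_split /= -[X in _ - (_ + X)]sum_einv -big_split /= -sumrB.
  apply: eq_bigr => e _; rewrite einvK -scalerDl -scalerBl /chain -/(n e) -/(n (einv e)).
  by congr (_ *: _); field.
rewrite opprB addrA addrAC; apply: Wk_add Wp _; apply: Wk_sum => e _.
by apply: Wk_scale; apply: tau_loop_einv_Wk2.
Qed.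

Variables (d : nat) (om oms : 'I_d -> E -> rat).
Hypotheses (om_cycle : forall i, is_cycle (om i))
  (oms_cycle : forall i, is_cycle (oms i))
  (oms_expand : forall w, is_cycle w ->
     w =1 fun e => \sum_i cycle_form w (om i) * oms i e)
  (om_dual : forall i j, cycle_form (oms i) (om j) = (i == j)%:R).
Local Notation sg := (asig om).

Definition gen (i : 'I_d) : A := \sum_e (2^-1 * oms i e) *: dl e.

Lemma gen_Wk1 i : Wk u u 1 (gen i).
Proof. by apply: Wk_sum => e _; apply: Wk_scale; apply: Wk_aug (is_path_tau_loop e). Qed.

(** The chain of [p] is a cycle; its coefficients in the basis [oms] are its pairings with the
    [om i], that is, the signature in length one. *)
Lemma loop_gen_Wk2 (p : seq E) : is_path u u p ->
  Wk u u 2 (pth p - 1 - \sum_i signature om p [:: i] *: gen i).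
Proof.
move=> pp; have -> : \sum_i signature om p [:: i] *: gen i
                    = \sum_e (2^-1 * chain p e) *: dl e; last exact: loop_chain_Wk2.
under eq_bigr => i _ do rewrite scaler_sumr; rewrite exchange_big /=.
apply: eq_bigr => e _; rewrite (oms_expand (chain_cycle pp)) mulr_sumr scaler_suml.
apply: eq_bigr => i _; rewrite scalerA; congr (_ *: _).
by rewrite signature1 (cycle_form_chain _ (proj1 (om_cycle i))) mulrCA.
Qed.

(** The paths [tau] contribute a difference of potentials [h (s e) - h (t e)], and this sums to zero
    against the cycle [oms i]. *)
Lemma sig_gen1 i j : sg [:: j] (gen i) = (i == j)%:R.
Proof.
pose h x := signature om (tau x) [:: j].
have sdl e : sg [:: j] (dl e) = h (s e) + len e * om j e - h (t e).
  rewrite linearB /= asig_pth asig_1 /unit_word /= subr0 /h !signature1.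
  by rewrite /tau_loop big_cat big_cons (sum_pinv _ (proj1 (om_cycle j))) /= !addrA.
rewrite -om_dual /gen linear_sum /cycle_form mulr_sumr.
rewrite (eq_bigr (fun e => 2^-1 * (len e * oms i e * om j e)
   + (2^-1 * (oms i e * h (s e)) - 2^-1 * (oms i e * h (t e))))); last first.
  by move=> e _; rewrite linearZ /= sdl; ring.
rewrite big_split /= sumrB -!mulr_sumr sum_cycle_src // sum_cycle_tgt //.
by rewrite mulr0 oppr0 !addr0 mulr_sumr.
Qed.

End Generators.

(** * Words of given length *)

Section Words.
Variable d : nat.

Fixpoint words (k : nat) : seq (seq 'I_d) :=
  if k is k'.+1 then [seq i :: w | i <- enum 'I_d, w <- words k'] else [:: [::]].

Lemma size_words k I : (I \in words k) = (size I == k).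
Proof.
elim: k I => [|k IHk] [|i I] //=; first by apply/allpairsP => -[[j J] []].
rewrite eqSS -IHk; apply/allpairsP/idP => [[[j J] [_ /= Jw [_ ->]]] //|Iw].
by exists (i, I); rewrite mem_enum.
Qed.

Lemma uniq_words k : uniq (words k).
Proof.
elim: k => [|k IHk] //=; apply: allpairs_uniq => //; first exact: enum_uniq.
by move=> [i I] [j J] _ _ /= [-> ->].
Qed.

Lemma sum_words0 (M : nmodType) (F : seq 'I_d -> M) : \sum_(I <- words 0) F I = F [::].
Proof. by rewrite big_seq1. Qed.

Lemma sum_wordsS (M : nmodType) k (F : seq 'I_d -> M) :
  \sum_(I <- words k.+1) F I = \sum_i \sum_(I <- words k) F (i :: I).
Proof. by rewrite big_allpairs_dep big_enum. Qed.

Lemma sum_words_delta (c : seq 'I_d -> rat) k J : size J = k ->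
  \sum_(I <- words k) c I * (I == J)%:R = c J.
Proof.
move=> sJ; rewrite (bigD1_seq J) ?uniq_words ?size_words ?sJ //= eqxx mulr1.
by rewrite big1 ?addr0 // => I /negPf ->; rewrite mulr0.
Qed.

End Words.

(** * Unitriangularity of signatures along the filtration *)

Section Filtration.
Variables (G : rmgraph) (u v : V G).
Local Notation E := (E G).
Local Notation V := (V G).
Local Notation A := (free_word_algebra E).
Implicit Types (a b : A).

Variables (d : nat) (om : 'I_d -> E -> rat) (g : 'I_d -> A) (p0 : seq E).
Local Notation sg := (asig om).
Hypotheses (om_antisym : forall i, antisym (om i)) (p0P : is_path u v p0)
  (g_Wk1 : forall i, Wk u u 1 (g i))
  (g_span : forall p, is_path u u p ->
     Wk u u 2 (pth p - 1 - \sum_i signature om p [:: i] *: g i))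
  (g_dual : forall i j, sg [:: j] (g i) = (i == j)%:R).

(** A factor [p - 1] has signature zero on the empty word, so each of the [k] factors consumes at
    least one letter. *)
Lemma Wk_sig_low w k a I : Wk u w k a -> (size I < k)%N -> sg I a = 0.
Proof.
move=> Wa; elim: Wa I => {k a}
  [//|k p a pp _ IHa|k p q _ _ hpq|k|k z a b _ IHa _ IHb] I sI.
- rewrite asig_M; apply: (conv_low (k := 1) (l := k)) => // J sJ.
  rewrite (size0nil (s := J)); last by case: (size J) sJ.
  by rewrite linearB /= asig_pth asig_1 signature0 subrr.
- by rewrite linearB /= !asig_pth (signature_homotopic om_antisym hpq) subrr.
- exact: linear0.
- by rewrite linearP /= IHa // IHb // mulr0 addr0.
Qed.

Fixpoint mon (I : seq 'I_d) : A := if I is i :: I' then g i * mon I' else pth p0.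

Lemma mon_Wk I : Wk u v (size I) (mon I).
Proof.
elim: I => [|i I IHI]; first exact: Wk_path.
exact: Wk_M (g_Wk1 i) IHI.
Qed.

(** Only the cut after the first letter survives: [g i] kills the empty prefix, and a longer prefix
    leaves a suffix too short for the remaining monomial. *)
Lemma sig_mon I J : size J = size I -> sg J (mon I) = (I == J)%:R.
Proof.
elim: I J => [|i I IHI] [|j J] //=; first by rewrite asig_pth signature0.
move=> [sJ]; rewrite asig_M conv_cons (Wk_sig_low (g_Wk1 i)) // mul0r add0r.
rewrite /conv big_ord_recl take0 drop0 g_dual (IHI _ sJ) eqseq_cons.
rewrite big1 ?addr0 => [|k _]; first by case: (i == j); rewrite ?mul1r ?mul0r.
rewrite [sg _ (mon I)](Wk_sig_low (mon_Wk I)) ?mulr0 // size_drop -sJ.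
by rewrite ltn_subrL /= (leq_ltn_trans (leq0n _) (ltn_ord k)).
Qed.

(** Modulo the next level only the linear part of a factor [p - 1] and the leading part of what it
    multiplies matter, so monomials suffice. *)
Lemma Wk_leading k a : Wk u v k a ->
  exists c : seq 'I_d -> rat, Wk u v k.+1 (a - \sum_(I <- words d k) c I *: mon I).
Proof.
elim=> {k a} [p pp|k p a pp _ [c Wc]|k p q pp pq hpq|k|k z a b _ [c Wc] _ [c' Wc']].
- exists (fun=> 1); rewrite sum_words0 scale1r /=.
  (* Up to homotopy [p] is the loop [q] followed by [p0], so [p - p0] becomes [(q - 1) p0], of level
     1. *)
  pose q := p ++ pinv p0.
  have pq : is_path u u q := is_path_cat pp (is_path_pinv p0P).
  have -> : pth p - pth p0 = (pth p - pth (q ++ p0)) + (pth q - 1) * pth p0.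
    by rewrite pth_cat mulrBl mul1r addrA subrK.
  apply: Wk_add; last by apply: Wk_mul => //; apply: Wk_path.
  apply: Wk_htpy => //; first exact: is_path_cat pq p0P.
  apply: rst_sym; have := homotopic_pinv (is_path_pinv p0P); rewrite pinvK => h.
  by have := homotopic_ctx pp (path_nil v) h; rewrite !cats0 /q -catA.
- exists (fun I => if I is i :: I' then signature om p [:: i] * c I' else 0).
  set S := \sum_(I <- _) c I *: _ in Wc; pose t := \sum_i signature om p [:: i] *: g i.
  have -> : \sum_(I <- words d k.+1)
      (if I is i :: I' then signature om p [:: i] * c I' else 0) *: mon I = t * S.
    rewrite sum_wordsS mulr_suml; apply: eq_bigr => i _.
    rewrite mulr_sumr; apply: eq_bigr => I _.
    by rewrite -scalerAl -scalerAr scalerA.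
  (* Both error terms have level [k.+1] or more: the first by the choice of [c], the second by
     [g_span]. *)
  have -> : (pth p - 1) * a - t * S = (pth p - 1) * (a - S) + (pth p - 1 - t) * S.
    by rewrite mulrBr [(_ - t) * S]mulrBl addrA subrK.
  apply: Wk_add; first exact: Wk_mul.
  apply: (Wk_M (k := 2) (l := k)); first exact: g_span.
  apply: Wk_sum => I; rewrite size_words => /eqP <-.
  by apply: Wk_scale; apply: mon_Wk.
- exists (fun=> 0); rewrite big1 ?subr0 => [|I _]; last by rewrite scale0r.
  exact: Wk_htpy.
- by exists (fun=> 0); rewrite big1 ?subr0 => [|I _]; [apply: Wk_0|rewrite scale0r].
- exists (fun I => z * c I + c' I).
  under eq_bigr => I _ do rewrite scalerDl -scalerA.
  by rewrite big_split /= -scaler_sumr opprD addrACA -scalerBr; apply: Wk_lin.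
Qed.

Lemma sig_sum_mon k c J : size J = k ->
  sg J (\sum_(I <- words d k) c I *: mon I) = c J.
Proof.
move=> sJ; rewrite linear_sum -[RHS](sum_words_delta _ sJ).
rewrite !big_seq; apply: eq_bigr => I; rewrite size_words => /eqP sI.
by rewrite linearZ /= sig_mon // sJ sI.
Qed.

Lemma Wk_sum_mon k c : Wk u v k (\sum_(I <- words d k) c I *: mon I).
Proof.
apply: Wk_sum => I; rewrite size_words => /eqP <-.
by apply: Wk_scale; apply: mon_Wk.
Qed.

(** Climbing one level at a time, the leading coefficients at level [n] are the signatures of length
    [n]; when these vanish the level rises. *)
Lemma Wk_sigP n a : Wk u v 0 a ->
  (forall I, (size I < n)%N -> sg I a = 0) <-> Wk u v n a.
Proof.
move=> Wa; split=> [s0|Wn I sI]; last exact: Wk_sig_low Wn sI.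
elim: n s0 => [//|n IHn] s0.
have /Wk_leading [c Wc] : Wk u v n a by apply: IHn => I sI; apply: s0; apply: ltnW.
suff S0 : \sum_(I <- words d n) c I *: mon I = 0 by rewrite S0 subr0 in Wc.
rewrite big_seq big1 // => I; rewrite size_words => /eqP sI.
have := Wk_sig_low Wc (I := I); rewrite linearB /= sig_sum_mon // sI ltnSn s0 ?sI //.
by rewrite sub0r => /(_ isT) /eqP; rewrite oppr_eq0 => /eqP ->; rewrite scale0r.
Qed.

(** Triangular solution of the prescribed signatures [f]: each stage corrects one length and leaves
    the shorter ones unchanged. *)
Fixpoint approx (f : seq 'I_d -> rat) (n : nat) : A :=
  if n is n'.+1 then
    approx f n' + \sum_(I <- words d n') (f I - sg I (approx f n')) *: mon I
  else 0.

Lemma approx_Wk0 f n : Wk u v 0 (approx f n).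
Proof.
elim: n => [|n IHn] /=; first exact: Wk_0.
by apply: Wk_add => //; apply: Wk_le (Wk_sum_mon _ _).
Qed.

Lemma approx_step f n : Wk u v n (approx f n.+1 - approx f n).
Proof. by rewrite /= addrC addKr; apply: Wk_sum_mon. Qed.

Lemma sig_approx f n I : (size I < n)%N -> sg I (approx f n) = f I.
Proof.
elim: n => [//|n IHn]; rewrite ltnS leq_eqVlt => /orP[/eqP sI|sI] /=.
  by rewrite linearD /= sig_sum_mon // addrC subrK.
by rewrite linearD /= IHn // (Wk_sig_low (Wk_sum_mon _ _) sI) addr0.
Qed.

End Filtration.

(** * Tensors of cycles in the basis of words *)

Section Tensors.
Variables (G : rmgraph) (d : nat) (om oms : 'I_d -> E G -> rat).
Hypotheses (om_cycle : forall i, is_cycle (om i))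
  (om_expand : forall w, is_cycle w ->
     w =1 fun e => \sum_i cycle_form w (oms i) * om i e).

Definition word_tensor (I : seq 'I_d) : tensor G := pure (map om I).

Lemma pure_expand (ws : seq (E G -> rat)) : (forall w, List.In w ws -> is_cycle w) ->
  exists c, pure ws =1 fun es => \sum_(I <- words d (size ws)) c I * word_tensor I es.
Proof.
elim: ws => [|w ws IHws] wsC.
  by exists (fun=> 1) => es; rewrite sum_words0 mul1r.
have [c cE] := IHws (fun w' w'in => wsC w' (or_intror w'in)).
have wE := om_expand (wsC w (or_introl erefl)).
exists (fun I => if I is i :: I' then cycle_form w (oms i) * c I' else 0) => es.
rewrite sum_wordsS; case: es => [|e es].
  rewrite pure_size // !big1 // => i _; rewrite big1 // => I _.
  by rewrite /word_tensor pure_size ?mulr0.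
rewrite pure_cons cE wE mulr_suml; apply: eq_bigr => i _.
rewrite mulr_sumr; apply: eq_bigr => I _.
by rewrite /word_tensor /= pure_cons mulrACA.
Qed.

Lemma H1T_expand m T : H1T m T ->
  exists c, T =1 fun es => \sum_(I <- words d m) c I * word_tensor I es.
Proof.
move=> [r [rP TE]].
suff [c cE] : exists c, (fun es => \sum_(a <- r) a.1 * pure a.2 es)
    =1 fun es => \sum_(I <- words d m) c I * word_tensor I es.
  by exists c => es; rewrite TE cE.
elim: r rP {TE} => [|a r IHr] rP.
  by exists (fun=> 0) => es; rewrite big_nil big1 // => I _; rewrite mul0r.
have [c cE] := IHr (fun b bin => rP b (or_intror bin)).
have [am aC] := rP a (or_introl erefl); have [c' c'E] := pure_expand aC.
rewrite am in c'E; exists (fun I => a.1 * c' I + c I) => es.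
rewrite big_cons cE c'E mulr_sumr -big_split; apply: eq_bigr => I _ /=.
by rewrite mulrDl mulrA.
Qed.

Lemma H1T_sum m (r : seq (seq 'I_d)) c : all (fun I => size I == m) r ->
  H1T m (fun es => \sum_(I <- r) c I * word_tensor I es).
Proof.
move=> /allP rm; exists [seq (c w, map om w) | w <- r]; split; last first.
  by move=> es; rewrite big_map.
elim: r rm => [//|I r IHr] rm a /= [<-|]; last first.
  by apply: IHr => J Jr; apply: rm; rewrite inE Jr orbT.
split; first by rewrite size_map (eqP (rm _ (mem_head _ _))).
by elim: I {rm} => //= i I IHI w [<-|/IHI].
Qed.

Lemma H1T_word I : H1T (size I) (word_tensor I).
Proof.
have := @H1T_sum (size I) [:: I] (fun=> 1); rewrite /= eqxx => /(_ isT).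
by congr H1T; apply: functional_extensionality => es; rewrite big_seq1 mul1r.
Qed.

Lemma cpair_comb_sum x m (r : seq (seq 'I_d)) c : all (fun I => size I == m) r ->
  cpair_comb x m (fun es => \sum_(I <- r) c I * word_tensor I es)
  = \sum_(I <- r) c I * asig om I (ev x).
Proof.
move=> /allP rm; rewrite /cpair_comb.
under eq_bigr => a _ do rewrite /cpair Irev_sum mulr_sumr.
rewrite exchange_big /= !big_seq; apply: eq_bigr => I /rm /eqP <-.
rewrite /asig lift_ev mulr_sumr; apply: eq_bigr => a _.
by rewrite mulrCA.
Qed.

Lemma cpair_comb_word x I : cpair_comb x (size I) (word_tensor I) = asig om I (ev x).
Proof. by rewrite /asig lift_ev. Qed.

Lemma lin_on_sum m phi (r : seq (seq 'I_d)) c :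
  lin_on m phi -> all (fun I => size I == m) r ->
  phi (fun es => \sum_(I <- r) c I * word_tensor I es)
  = \sum_(I <- r) c I * phi (word_tensor I).
Proof.
move=> lphi; elim: r => [|I r IHr] /= => [_|/andP[/eqP sI rm]].
  have H0 : H1T m (fun _ : seq (E G) => 0).
    have := @H1T_sum m [::] (fun=> 0) isT.
    by congr H1T; apply: functional_extensionality => es; rewrite big_nil.
  (* Linearity with scalar -1 and both tensors zero gives the value 0 on the zero tensor. *)
  rewrite big_nil; have -> : (fun es => \sum_(I <- [::]) c I * word_tensor I es)
      = (fun es : seq (E G) => -1 * 0 + 0).
    by apply: functional_extensionality => es; rewrite big_nil mulr0 addr0.
  by rewrite lphi // [in LHS]mulN1r addNr.
have Hr := H1T_sum c rm; have HI := H1T_word I; rewrite sI in HI.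
rewrite big_cons -(IHr rm) -(lphi _ _ _ HI Hr); congr phi.
by apply: functional_extensionality => es; rewrite big_cons.
Qed.

Lemma all_words m : all (fun I => size I == m) (words d m).
Proof. by apply/allP => I; rewrite size_words. Qed.

End Tensors.

(** * Perfectness of the pairing and the inverse limit *)

Lemma cpair_zero (G : rmgraph) (p : seq (E G)) m : cpair p m (fun=> 0) = 0.
Proof.
rewrite -[RHS](mul0r (cpair p m (fun=> 0))) -Irev_scale.
by apply: eq_Irev => es; rewrite mul0r.
Qed.

Theorem theorem4p2 (G : rmgraph) (hne : (0 < #|V G|)%N) (hconn : connected G)
    (u v : V G) :
  (forall n : nat,
     (* left kernel of the pairing on Q pi_1 (x) (+)_{m<=n} H_1^{(x)m} is W_{-n-1}
        (so the pairing is well defined on Q pi_1/W_{-n-1} and injective there) *)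
     (forall x : comb G, valid u v x ->
        ((forall m T, (m <= n)%N -> H1T m T -> cpair_comb x m T = 0) <->
         inW u v n.+1 x)) /\
     (* surjectivity onto (+)_{m<=n} H^1^{(x)m} *)
     (forall phi : nat -> tensor G -> rat, (forall m, lin_on m (phi m)) ->
        exists x : comb G, valid u v x /\
          forall m T, (m <= n)%N -> H1T m T -> cpair_comb x m T = phi m T) /\
     (* right kernel is zero *)
     (forall Ts : nat -> tensor G, (forall m, H1T m (Ts m)) ->
        (forall p, is_path u v p -> \sum_(m < n.+1) cpair p m (Ts m) = 0) ->
        forall m, (m <= n)%N -> Ts m =1 (fun _ => 0))) /\
  (* the induced map lim_n Q pi_1/W_{-n-1} -> prod_m H^1^{(x)m},
     (x_n)_n |-> (int_{x_m} restricted to H_1^{(x)m})_m, is bijective *)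
  (forall x y : nat -> comb G, compatible u v x -> compatible u v y ->
     (lim_eq u v x y <->
      forall m T, H1T m T -> cpair_comb (x m) m T = cpair_comb (y m) m T)) /\
  (forall phi : nat -> tensor G -> rat, (forall m, lin_on m (phi m)) ->
     exists x : nat -> comb G, compatible u v x /\
       forall m T, H1T m T -> cpair_comb (x m) m T = phi m T).
Proof.
have [d [om [oms [om_cycle oms_cycle om_expand oms_expand om_dual]]]] :=
  cycle_dual_basis G.
(* The constant path is forced at [u], as [tau_base] requires; elsewhere connectedness supplies a
   path. *)
pose tau x := if x == u then [::] else xchoose (hconn u x).
have tauP x : is_path u x (tau x).
  by rewrite /tau; case: eqP => [->|_]; [apply: path_nil|apply: xchooseP].
have tau_base : tau u = [::] by rewrite /tau eqxx.
pose g := gen tau oms; pose sg := asig om.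
have om_antisym i : antisym (om i) := proj1 (om_cycle i).
have g1 i : Wk u u 1 (g i) := gen_Wk1 tauP oms i.
have g_span := loop_gen_Wk2 tauP tau_base om_cycle oms_expand.
have g_dual := sig_gen1 tau om_cycle oms_cycle om_dual.
have p0P := tauP v.
pose mon := mon g (tau v); pose approx := approx om g (tau v).
have WsigP n (a : free_word_algebra (E G)) : Wk u v 0 a ->
    (forall I, (size I < n)%N -> sg I a = 0) <-> Wk u v n a.
  exact: (Wk_sigP om_antisym p0P g1 g_span g_dual).
have expand m T : H1T m T -> exists c,
    T = fun es => \sum_(I <- words d m) c I * word_tensor om I es.
  move=> /(H1T_expand om_expand) [c Tc]; exists c.
  exact: functional_extensionality.
(* Word tensors span each degree, so comparing pairings amounts to comparing signatures. *)
have pairP x y m : (forall T, H1T m T -> cpair_comb x m T = cpair_comb y m T) <->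
    (forall I, size I = m -> sg I (ev x) = sg I (ev y)).
  split=> [xy I sI|xy T /expand [c ->]].
    by rewrite -sI in xy; rewrite /sg -!cpair_comb_word; apply: xy; apply: H1T_word.
  rewrite !cpair_comb_sum ?all_words // !big_seq; apply: eq_bigr => I.
  by rewrite size_words => /eqP /xy <-.
have pair0 m (T : tensor G) : cpair_comb [::] m T = 0.
  by rewrite /cpair_comb big_nil.
have ev0 : ev [::] = 0 :> free_word_algebra (E G) by rewrite /ev big_nil.
have kernel n x : valid u v x ->
    (forall m T, (m <= n)%N -> H1T m T -> cpair_comb x m T = 0) <-> inW u v n.+1 x.
  move=> vx; rewrite inWE -(WsigP _ _ (valid_Wk vx)); split=> [x0 I sI|x0 m T mn].
    have /pairP/(_ I erefl) : forall T, H1T (size I) T ->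
      cpair_comb x (size I) T = cpair_comb [::] (size I) T.
      by move=> T /x0 -> //; rewrite pair0.
    by rewrite ev0 linear0.
  rewrite -(pair0 m T); move: T; apply/pairP => I sI.
  by rewrite ev0 linear0 x0 // sI.
have pair_phi phi x m : lin_on m phi ->
    (forall I, size I = m -> sg I (ev x) = phi (word_tensor om I)) ->
    forall T, H1T m T -> cpair_comb x m T = phi T.
  move=> lphi xphi T /expand [c ->].
  rewrite cpair_comb_sum ?all_words // (lin_on_sum om_cycle _ lphi) ?all_words //.
  rewrite !big_seq; apply: eq_bigr => I; rewrite size_words => /eqP /xphi <- //.
pose coeffs (phi : nat -> tensor G -> rat) I := phi (size I) (word_tensor om I).
have approx0 f n : Wk u v 0 (approx f n) := approx_Wk0 om p0P g1 f n.
have sig_approx f n I : (size I < n)%N -> sg I (approx f n) = f I.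
  exact: (sig_approx om_antisym p0P g1 g_dual).
split; [move=> n; split; [|split]|split].
- exact: kernel.
(* Stage [n.+1] has the prescribed signatures on all words of length at most [n]. *)
- move=> phi lphi; exists (comb_of (approx (coeffs phi) n.+1)).
  split=> [|m T mn]; first exact: valid_comb_of (approx0 _ _).
  apply: pair_phi => // I sI.
  by rewrite comb_ofK sig_approx /coeffs sI.
- move=> Ts TsH Ts0.
  have comb0 x : valid u v x -> \sum_(m < n.+1) cpair_comb x m (Ts m) = 0.
    move=> /allP vx; rewrite exchange_big /= big_seq big1 // => z /vx zp.
    by rewrite -mulr_sumr Ts0 // mulr0.
  (* Descending induction on the degree [m]. Paired with the monomial of a word [I] of length [m],
     lower degrees give zero and higher tensors already vanish, so only [c I] remains. *)
  suff H k m : (n < m + k)%N -> (m <= n)%N -> Ts m = (fun=> 0).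
    by move=> m mn es; rewrite (H n.+1 m) // addnS ltnS leq_addl.
  elim: k m => [|k IHk] m; first by rewrite addn0 ltnNge => /negbTE ->.
  move=> nmk mn; have [c Tc] := expand _ _ (TsH m).
  rewrite Tc; apply: functional_extensionality => es; rewrite big_seq big1 // => I.
  rewrite size_words => /eqP sI.
  have Wm := mon_Wk p0P g1 I.
  have := comb0 (comb_of (mon I)) (valid_comb_of Wm).
  have mn' : (m < n.+1)%N by [].
  rewrite (bigD1 (Ordinal mn')) //= Tc cpair_comb_sum ?all_words //.
  rewrite comb_ofK; under eq_bigr => J _ do rewrite -/sg.
  rewrite [X in X + _](_ : _ = c I); last first.
    rewrite -[RHS](sum_words_delta _ sI) !big_seq; apply: eq_bigr => J.
    rewrite size_words => /eqP sJ.
    by rewrite /sg (sig_mon om_antisym p0P g1 g_dual) ?sJ // eq_sym.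
  rewrite big1 ?addr0 => [->|]; first by rewrite mul0r.
  move=> [j jn] /= jm.
  have {}jm : j != m by apply: contra jm => /eqP jm; apply/eqP/val_inj.
  have [jltm|mltj|jm'] := ltngtP j m; last by rewrite jm' eqxx in jm.
    rewrite -(pair0 j (Ts j)); move: (Ts j) (TsH j); apply/pairP => J sJ.
    by rewrite comb_ofK ev0 linear0 /sg (Wk_sig_low om_antisym Wm) // sJ sI.
  rewrite (IHk j) ?(leq_trans nmk) ?addnS ?ltnS -?addSn ?leq_add2r //.
  by rewrite /cpair_comb big1 // => z _; rewrite cpair_zero mulr0.
- move=> x y [vx cx] [vy cy].
  (* Consecutive terms differ by an element of level [n.+1], whose signature vanishes on words of
     length at most [n]. *)
  have stable z : compatible u v z -> forall n I, (size I <= n)%N ->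
      sg I (ev (z n)) = sg I (ev (z (size I))).
    move=> [_ cz] n I /subnK <-; elim: (n - size I)%N => [//|k IHk].
    have /inWE := cz (k + size I)%N; rewrite ev_csub => Wz.
    have := Wk_sig_low om_antisym Wz (I := I); rewrite ltnS leq_addl => /(_ isT).
    by rewrite linearB /= => /eqP; rewrite subr_eq0 -/sg => /eqP ->.
  have W0 n : Wk u v 0 (ev (x n) - ev (y n)).
    by apply: Wk_sub; apply: valid_Wk.
  split=> [xy m|xy n].
    apply/pairP => I sI; have /inWE := xy m; rewrite ev_csub => /WsigP -/(_ (W0 m)).
    by move=> /(_ I); rewrite sI ltnSn linearB => /(_ isT) /eqP; rewrite subr_eq0 => /eqP.
  apply/inWE; rewrite ev_csub; apply/WsigP => // I; rewrite ltnS => sI.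
  (* The hypothesis compares degree [m] only at index [m], so each word is moved to the index given
     by its length. *)
  rewrite linearB /= (stable x) // (stable y) //.
  by have /pairP -> := xy (size I); rewrite ?subrr.
- move=> phi lphi; pose f := coeffs phi.
  (* The shift makes the [n]-th term correct up to length [n], and consecutive terms differ by
     monomials of length [n.+1]. *)
  exists (fun n => comb_of (approx f n.+1)); split.
    split=> n; first exact: valid_comb_of (approx0 _ _).
    apply/inWE; rewrite ev_csub !comb_ofK.
    exact: (approx_step om p0P g1 f n.+1).
  move=> m; apply: pair_phi => // I sI.
  by rewrite comb_ofK sig_approx ?sI // /f /coeffs sI.
Qed.
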